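(* Let $G$ be a finite simple graph with spectral radius $\lambda(G)$ and clique number $\omega(G)=\omega\geq 2$. For each edge $e\in E(G)$, let $c(e)$ be the order of the largest clique of $G$ containing $e$. Then $$\lambda(G) \leq \sqrt{2 \sum_{e\in E(G)} \frac{c(e) - 1}{c(e)}}.$$ Moreover, equality holds if and only if, possibly up to the presence of some isolated vertices, $G$ is a complete bipartite graph (when $\omega = 2$) or a complete regular $\omega$-partite graph (when $\omega \geq 3$).
   Context: The spectral radius $\lambda(G)$ of a graph $G$ is the largest eigenvalue of its adjacency matrix $A(G)$. The clique number $\omega(G)$ is the maximum order of a complete subgraph of $G$. A complete regular $\omega$-partite graph is a complete $\omega$-partite graph that is regular, i.e. whose $\omega$ (nonempty) vertex classes all have the same size. ''Possibly with some isolated vertices'' means that $G$ may be the disjoint union of such a graph with any number (including zero) of isolated vertices. *)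

(* Defs.v *)
From mathcomp Require Import classical_sets reals.
From mathcomp Require Import all_boot all_order all_algebra.
From mathcomp Require complex polyrcf.

Set Implicit Arguments.
Unset Strict Implicit.
Unset Printing Implicit Defensive.

Import Order.TTheory GRing.Theory Num.Theory.

Local Open Scope ring_scope.

(* A finite simple graph is a symmetric irreflexive adjacency relation
   [e : rel T] on a finite vertex type [T]; symmetry and irreflexivity are
   hypotheses of the theorem, not part of the definitions. *)

Definition edges (T : finType) (e : rel T) : {set {set T}} :=
  [set E : {set T} | [exists x, exists y, e x y && (E == [set x; y])]].

Definition clique (T : finType) (e : rel T) (A : {set T}) : bool :=
  [forall x in A, forall y in A, (x != y) ==> e x y].

Definition clique_number (T : finType) (e : rel T) : nat :=
  (\max_(A : {set T} | clique e A) #|A|)%N.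

Definition edge_clique_order (T : finType) (e : rel T) (E : {set T}) : nat :=
  (\max_(A : {set T} | clique e A && (E \subset A)) #|A|)%N.

Definition adjacency_mx (R : nzRingType) (T : finType) (e : rel T) : 'M[R]_#|T| :=
  \matrix_(i, j) (e (enum_val i) (enum_val j))%:R.

(* The supremum is attained: see [spectral_radius_largest] below. *)
Definition spectral_radius (R : realType) (T : finType) (e : rel T) : R :=
  sup [set mu : R | eigenvalue (adjacency_mx R e) mu]%classic.

(* [P] is the set of the k (nonempty) vertex classes; the vertices outside
   [cover P] are the isolated ones that are allowed to be present. *)
Definition complete_multipartite_classes
    (T : finType) (e : rel T) (k : nat) (P : {set {set T}}) : Prop :=
  [/\ trivIset P, set0 \notin P, #|P| = k &
      forall x y : T,
        e x y = [&& x \in cover P, y \in cover P & pblock P x != pblock P y]].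

Definition complete_bipartite_upto_isolated (T : finType) (e : rel T) : Prop :=
  exists P : {set {set T}}, complete_multipartite_classes e 2 P.

Definition complete_regular_multipartite_upto_isolated
    (T : finType) (e : rel T) (k : nat) : Prop :=
  exists P : {set {set T}},
    complete_multipartite_classes e k P /\ {in P &, forall A B : {set T}, #|A| = #|B|}.

Section SpectralRadius.

Import complex.

Lemma symmetric_eigenvalue (R : rcfType) (n : nat) (A : 'M[R]_n) :
  (0 < n)%N -> A^T = A -> exists mu : R, eigenvalue A mu.
Proof.
case: n A => [//|n] A _ symA.
pose C := (R[i])%C.
pose f : {rmorphism R -> C} := real_complex R.
have [z] : exists z : C, root (char_poly (map_mx f A)) z.
  by apply/closed_rootP; rewrite size_char_poly.
rewrite -eigenvalue_root_char => zA.
have /eigenvalueP[v vA vn0] := zA.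
pose w : 'cV[C]_n.+1 := map_mx Num.conj v^T.
have symE i j : A i j = A j i by rewrite -[in LHS]symA mxE.
have conjA : map_mx Num.conj (map_mx f A)^T = map_mx f A.
  apply/matrixP => i j; rewrite !mxE [A j i]symE.
  by apply: conj_Creal; apply/complex_realP; exists (A i j).
have Aw : map_mx f A *m w = (z^*)%R *: w.
  rewrite -[in LHS]conjA /w -map_mxM -trmx_mul vA.
  by apply/matrixP => i j; rewrite !mxE rmorphM.
have E : z *: (v *m w) = (z^*)%R *: (v *m w).
  by rewrite scalemxAl -vA -mulmxA Aw scalemxAr.
have vw0 : (v *m w) 0 0 != 0.
  have -> : (v *m w) 0 0 = \sum_j `|v 0 j| ^+ 2.
    by rewrite mxE; apply: eq_bigr => j _; rewrite !mxE normCK.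
  apply: contra vn0; rewrite psumr_eq0; last by move=> j _; exact: exprn_ge0.
  move=> /allP H; apply/eqP/rowP => j; rewrite mxE; apply/eqP.
  by have := H j (mem_index_enum j); rewrite /= expf_eq0 normr_eq0.
have zR : z \is Num.real.
  rewrite CrealE; apply/eqP.
  apply/esym/(mulIf vw0).
  by have := congr1 (fun M : 'M_1 => M 0 0) E; rewrite [LHS]mxE [RHS]mxE.
have /complex_realP[mu zE] := zR.
by exists mu; move: zA; rewrite zE (eigenvalue_map f).
Qed.

Lemma adjacency_mx_sym (R : nzRingType) (T : finType) (e : rel T) :
  symmetric e -> (adjacency_mx R e)^T = adjacency_mx R e.
Proof. by move=> esym; apply/matrixP => i j; rewrite !mxE esym. Qed.

Lemma spectral_radius_largest (R : realType) (T : finType) (e : rel T) :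
  symmetric e -> (0 < #|T|)%N ->
  eigenvalue (adjacency_mx R e) (spectral_radius R e) /\
  (forall mu : R, eigenvalue (adjacency_mx R e) mu -> mu <= spectral_radius R e).
Proof.
move=> esym T0; set A := adjacency_mx R e.
have [mu0 mu0A] := symmetric_eigenvalue T0 (adjacency_mx_sym R esym).
pose s := polyrcf.rootsR (char_poly A).
have sE mu : eigenvalue A mu = (mu \in s).
  rewrite eigenvalue_root_char -polyrcf.roots_on_rootsR ?in_itv //.
  by rewrite monic_neq0 // char_poly_monic.
have [i0 _] : exists2 i : 'I_(size s), true & s`_i = mu0.
  rewrite -/A sE in mu0A.
  have h : (index mu0 s < size s)%N by rewrite index_mem.
  by exists (Ordinal h) => //=; rewrite nth_index.
move=> _; pose i := [arg max_(j > i0) s`_j]%O.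
have imax (j : 'I_(size s)) : s`_j <= s`_i.
  by rewrite /i; case: arg_maxP => //= k _; apply.
have ub mu : eigenvalue A mu -> mu <= s`_i.
  rewrite sE => mus; have h : (index mu s < size s)%N by rewrite index_mem.
  by have := imax (Ordinal h); rewrite /= nth_index.
have iA : eigenvalue A s`_i by rewrite sE mem_nth.
have -> : spectral_radius R e = s`_i.
  apply/eqP; rewrite eq_le; apply/andP; split.
    by apply: ge_sup; [exists s`_i | move=> mu; exact: ub].
  by apply: ub_le_sup => //; exists s`_i => mu; exact: ub.
by split.
Qed.

End SpectralRadius.

(* Main.v *)
(* Give an edge uv the weight w(uv) = c(uv) / (c(uv) - 1). The local form of the
   Motzkin-Straus inequality says that sum_{u ~ v} w(uv) y_u y_v <= (sum_u y_u)^2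
   for y >= 0, the sum being over ordered pairs: shifting mass between two
   nonadjacent vertices of the support changes the form affinely, so the support
   may be assumed to be a clique of some order k, on which w <= k / (k - 1).
   For a unit eigenvector x of lambda, apply this with y = x^2 after
   Cauchy-Schwarz on lambda = sum_{u ~ v} x_u x_v with weights w.

   In the equality case w(uv) x_u x_v is the same nonzero number for all edges,
   so x does not vanish on the non-isolated vertices and y = x^2 is an interior
   maximiser of the form there. The second-order condition makes nonadjacency
   transitive, i.e. the graph complete multipartite. With at least three classes
   all entries of x coincide, so the degrees, hence the classes, are equal. *)

Require Import Defs.
From mathcomp Require Import classical_sets reals.
From mathcomp Require Import all_boot all_order all_algebra.
From mathcomp Require Import ring lra.

Set Implicit Arguments.
Unset Strict Implicit.
Unset Printing Implicit Defensive.

Import Order.TTheory GRing.Theory Num.Theory.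

Local Open Scope ring_scope.

(** * Weighted Cauchy-Schwarz inequality with its equality case *)

Section WeightedCauchy.

Context (R : realFieldType) (I : finType) (P : pred I) (w z : I -> R).
Hypothesis w_gt0 : forall i, P i -> 0 < w i.

(** Lagrange's identity for the vectors w^(-1/2) and w^(1/2) z, written without square roots.
    Inequality and equality case are both read off from it. *)
Lemma weighted_lagrange :
  \sum_(i | P i) \sum_(j | P j) (w i * z i - w j * z j) ^+ 2 / (w i * w j) =
  2 * ((\sum_(i | P i) (w i)^-1) * (\sum_(i | P i) w i * z i ^+ 2)
       - (\sum_(i | P i) z i) ^+ 2).
Proof.
transitivity (\sum_(i | P i) \sum_(j | P j)
   ((w j)^-1 * (w i * z i ^+ 2) + (w i)^-1 * (w j * z j ^+ 2) - 2 * (z i * z j))).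
  apply: eq_bigr => i /w_gt0 wi; apply: eq_bigr => j /w_gt0 wj.
  by field; rewrite !gt_eqF.
under eq_bigr do rewrite !big_split /= sumrN -mulr_suml -!mulr_sumr.
by rewrite !big_split /= sumrN -!mulr_sumr -!mulr_suml; ring.
Qed.

Lemma weighted_cauchy :
  (\sum_(i | P i) z i) ^+ 2 <=
  (\sum_(i | P i) (w i)^-1) * (\sum_(i | P i) w i * z i ^+ 2).
Proof.
rewrite -subr_ge0 -(pmulr_rge0 _ (ltr0Sn R 1)) -weighted_lagrange.
apply: sumr_ge0 => i /w_gt0 wi; apply: sumr_ge0 => j /w_gt0 wj.
by rewrite divr_ge0 ?sqr_ge0 ?ltW ?mulr_gt0.
Qed.

Lemma weighted_cauchy_eq :
  (\sum_(i | P i) z i) ^+ 2 =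
    (\sum_(i | P i) (w i)^-1) * (\sum_(i | P i) w i * z i ^+ 2) ->
  forall i j, P i -> P j -> w i * z i = w j * z j.
Proof.
have pos i j : P i -> P j -> 0 <= (w i * z i - w j * z j) ^+ 2 / (w i * w j).
  by move=> /w_gt0 wi /w_gt0 wj; rewrite divr_ge0 ?sqr_ge0 ?ltW ?mulr_gt0.
move=> eqz i j Pi Pj; have := weighted_lagrange; rewrite -eqz subrr mulr0.
move/psumr_eq0P => /(_ (fun i Pi => sumr_ge0 _ (fun j Pj => pos i j Pi Pj))).
move=> /(_ i Pi)/psumr_eq0P => /(_ (fun j Pj => pos i j Pi Pj))/(_ j Pj)/eqP.
rewrite mulf_eq0 sqrf_eq0 subr_eq0 invr_eq0.
by rewrite (gt_eqF (mulr_gt0 (w_gt0 Pi) (w_gt0 Pj))) orbF => /eqP.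
Qed.

End WeightedCauchy.

(** * Quadratic forms and their variation along a direction *)

Section QuadraticForm.

Context (R : realFieldType) (T : finType) (W : T -> T -> R).
Hypothesis W_sym : forall u v, W u v = W v u.

(** For symmetric [W], half the gradient of [qform] at [y]. *)
Definition qform_grad (y : T -> R) (u : T) : R := \sum_v W u v * y v.
Definition qform (y : T -> R) : R := \sum_u y u * qform_grad y u.

(** A sum of Kronecker deltas rather than a case split, so that the three vertices may coincide and
    their coefficients then add up. *)
Definition bump3 (a b c : R) (u v w : T) (i : T) : R :=
  (i == u)%:R * a + (i == v)%:R * b + (i == w)%:R * c.

Lemma sum_delta (u : T) (a : R) (g : T -> R) :
  \sum_i (i == u)%:R * a * g i = a * g u.
Proof.
rewrite (bigD1 u) //= eqxx mul1r big1 ?addr0 // => i /negPf ->.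
by rewrite !mul0r.
Qed.

Lemma sum_bump3 (a b c : R) (u v w : T) (g : T -> R) :
  \sum_i bump3 a b c u v w i * g i = a * g u + b * g v + c * g w.
Proof.
by under eq_bigr do rewrite !mulrDl; rewrite !big_split /= !sum_delta.
Qed.

Lemma qform_bump3 (a b c : R) (u v w : T) :
  qform (bump3 a b c u v w) =
  W u u * a ^+ 2 + W v v * b ^+ 2 + W w w * c ^+ 2
  + 2 * (W u v * (a * b) + W u w * (a * c) + W v w * (b * c)).
Proof.
have gE i : qform_grad (bump3 a b c u v w) i = a * W i u + b * W i v + c * W i w.
  by rewrite -sum_bump3; apply: eq_bigr => j _; rewrite mulrC.
by rewrite /qform sum_bump3 !gE (W_sym v u) (W_sym w u) (W_sym w v); ring.
Qed.

Lemma qformD (y d : T -> R) (s : R) :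
  qform (fun i => y i + s * d i) =
  qform y + 2 * s * (\sum_i d i * qform_grad y i) + s ^+ 2 * qform d.
Proof.
have gD i : qform_grad (fun i => y i + s * d i) i = qform_grad y i + s * qform_grad d i.
  by rewrite /qform_grad mulr_sumr -big_split; apply: eq_bigr => j _ /=; ring.
have sym : \sum_i y i * qform_grad d i = \sum_i d i * qform_grad y i.
  rewrite /qform_grad; under eq_bigr do rewrite mulr_sumr.
  rewrite exchange_big; apply: eq_bigr => i _ /=; rewrite mulr_sumr.
  by apply: eq_bigr => j _; rewrite (W_sym j i); ring.
rewrite -mulrA mulr_natl mulr2n -{1}sym /qform !mulr_sumr -!big_split; apply: eq_bigr => i _ /=.
by rewrite gD; ring.
Qed.

End QuadraticForm.

(** * The local Motzkin-Straus inequality and its second-order condition *)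

Section LocalMotzkinStraus.

Context (R : realFieldType) (T : finType) (e : rel T) (W : T -> T -> R).
Hypothesis e_sym : symmetric e.
Hypothesis e_irr : irreflexive e.
Hypothesis W_sym : forall u v, W u v = W v u.
Hypothesis W_nonadj : forall u v, ~~ e u v -> W u v = 0.
Hypothesis W_clique : forall (K : {set T}) u v, clique e K ->
  u \in K -> v \in K -> u != v -> W u v * (#|K|%:R - 1) <= #|K|%:R.

(** With k = |K|, [W_clique] gives (k - 1) Q(y) <= k ((sum y)^2 - sum y^2), and Cauchy-Schwarz gives
    (sum y)^2 <= k sum y^2. Together they bound (k - 1) Q(y) by (k - 1) (sum y)^2. *)
Lemma qform_le_clique (y : T -> R) (K : {set T}) : clique e K ->
  (forall u, 0 <= y u) -> (forall u, u \notin K -> y u = 0) ->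
  qform W y <= (\sum_u y u) ^+ 2.
Proof.
move=> clK y0 ysupp; set k : R := #|K|%:R.
have diag u : W u u = 0 by rewrite W_nonadj ?e_irr.
have sumK (g : T -> R) : (forall u, u \notin K -> g u = 0) ->
    \sum_u g u = \sum_(u in K) g u.
  move=> g0; rewrite [RHS]big_mkcond; apply: eq_bigr => u _.
  by case: ifPn => // /g0.
(* Cancelling k - 1 requires k >= 2; for smaller [K] only diagonal terms survive, and they are
   zero. *)
have [K1|K2] := leqP #|K| 1.
  rewrite /qform big1 ?sqr_ge0 // => u _.
  have [uK|uK] := boolP (u \in K); last by rewrite ysupp ?mul0r.
  rewrite /qform_grad big1 ?mulr0 // => v _.
  have [vK|vK] := boolP (v \in K); last by rewrite ysupp ?mulr0.
  by rewrite (card_le1_eqP K1 v u) // diag mul0r.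
have k1 : 0 < k - 1 by rewrite subr_gt0 ltr1n.
have kq : (\sum_u y u) ^+ 2 <= k * \sum_u y u ^+ 2.
  rewrite !sumK => //; last by move=> u /ysupp ->; rewrite expr0n.
  have := @weighted_cauchy R T (mem K) (fun=> 1) y (fun _ _ => ltr01).
  rewrite invr1 sumr_const; under [X in _ * X]eq_bigr do rewrite mul1r.
  by [].
have : (k - 1) * qform W y <= k * ((\sum_u y u) ^+ 2 - \sum_u y u ^+ 2).
  rewrite expr2 [in leRHS]mulr_suml -sumrB !mulr_sumr; apply: ler_sum => u _.
  rewrite /qform_grad mulr_sumr [y u ^+ 2]expr2.
  (* Removing the diagonal term by an indicator keeps both sums over all [v], ready for a termwise
     comparison. *)
  have -> : y u * \sum_v y v - y u * y u = \sum_v (y u * y v * (v != u)%:R).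
    rewrite (bigD1 u) //= mulrDr addrC addKr.
    rewrite [RHS](bigD1 u) //= eqxx mulr0 add0r mulr_sumr.
    by apply: eq_bigr => v ->; rewrite mulr1.
  rewrite !mulr_sumr; apply: ler_sum => v _.
  have [uK|/ysupp ->] := boolP (u \in K); last by rewrite !mul0r !mulr0.
  have [vK|/ysupp ->] := boolP (v \in K); last by rewrite !(mul0r, mulr0).
  have [->|vu] := eqVneq v u; first by rewrite diag !(mul0r, mulr0).
  have := W_clique clK uK vK; rewrite eq_sym => /(_ vu) Wle.
  have yy : 0 <= y u * y v by rewrite mulr_ge0.
  have := ler_wpM2l yy Wle; rewrite -/k mulr1; lra.
move=> kQ; rewrite -(ler_pM2l k1); lra.
Qed.

(** Induction on the size of the support: unless it is a clique, mass can be moved between two of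
    its nonadjacent vertices so that one of them leaves the support and the form does not
    decrease. *)
Lemma qform_le (y : T -> R) : (forall u, 0 <= y u) ->
  qform W y <= (\sum_u y u) ^+ 2.
Proof.
have [n] := ubnP #|[set u | y u != 0]|; elim: n y => // n IHn y leyn y0.
set S := [set u | y u != 0].
have diag u : W u u = 0 by rewrite W_nonadj ?e_irr.
have [clS|] := boolP (clique e S).
  by apply: (@qform_le_clique _ S) => // u; rewrite inE negbK => /eqP.
rewrite negb_forall => /existsP[u]; rewrite negb_imply => /andP[uS].
rewrite negb_forall => /existsP[v]; rewrite negb_imply => /andP[vS].
rewrite negb_imply => /andP[].
wlog Huv : u v uS vS / qform_grad W y v <= qform_grad W y u.
  move=> H uv euv; have [|/ltW] := leP (qform_grad W y v) (qform_grad W y u).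
    by move/H; apply.
  by move/H; apply; rewrite // 1?eq_sym // e_sym.
move=> uv euv.
(* Move all the mass of [v] to [u], which has the larger partial derivative. *)
pose d : T -> R := bump3 1 (-1) 0 u v u; pose z i := y i + y v * d i.
have zv : z v = 0 by rewrite /z /d /bump3 eqxx eq_sym (negPf uv) /=; ring.
have z0 i : 0 <= z i.
  have [->|iv] := eqVneq i v; first by rewrite zv.
  rewrite /z addr_ge0 // mulr_ge0 // /d /bump3 (negPf iv) !(mul0r, mulr0, addr0).
  by rewrite mulr1 ler0n.
have -> : \sum_u y u = \sum_u z u.
  rewrite big_split /= -mulr_sumr; under [X in _ * X]eq_bigr do rewrite -[d _]mulr1.
  by rewrite sum_bump3; ring.
apply: le_trans (IHn z _ z0).
  (* The quadratic term vanishes because [u] and [v] are nonadjacent, so the form grows by 2 y_v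
     times the difference of the partial derivatives. *)
  rewrite qformD // qform_bump3 // sum_bump3 !diag W_nonadj //.
  have yv := y0 v; have := mulr_ge0 yv (_ : 0 <= qform_grad W y u - qform_grad W y v).
  by rewrite subr_ge0 => /(_ Huv); lra.
rewrite -ltnS; apply: leq_trans leyn; rewrite ltnS proper_card //; apply/properP; split.
  apply/subsetP => i; rewrite !inE; apply: contra => /eqP yi.
  rewrite /z yi /d /bump3 add0r; have [iu|] := eqVneq i u.
    by move: uS; rewrite inE -iu yi eqxx.
  have [iv|] := eqVneq i v; first by move: vS; rewrite inE -iv yi eqxx.
  by rewrite !mul0r !addr0 mulr0.
by exists v => //; rewrite inE zv eqxx.
Qed.

(* Second-order condition at an interior maximiser, along [u + w - 2 v]. *)
Lemma qform_eq_nonadj_trans (y : T -> R) (u v w : T) : (forall u, 0 <= y u) ->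
  (forall u v, e u v -> 0 < W u v) ->
  qform W y = (\sum_u y u) ^+ 2 -> 0 < y u -> 0 < y v -> 0 < y w ->
  ~~ e u v -> ~~ e v w -> ~~ e u w.
Proof.
move=> y0 W_gt0 yQ yu yv yw uv vw; apply/negP => uw.
have diag x : W x x = 0 by rewrite W_nonadj ?e_irr.
(* Small enough for y + s d and y - s d to stay nonnegative; the half accounts for the coefficient
   -2 at [v]. *)
pose s := Num.min (y u) (Num.min (y v / 2) (y w)).
have s0 : 0 < s by rewrite !lt_min yu yw divr_gt0.
have su : s <= y u by rewrite ge_min lexx.
have sv : s <= y v / 2 by rewrite !ge_min lexx ?orbT.
have sw : s <= y w by rewrite !ge_min lexx ?orbT.
pose d : T -> R := bump3 1 (-2) 1 u v w.
have wu : u != w by apply: contraTneq uw => ->; rewrite e_irr.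
have vu : u != v by apply: contraNneq vw => <-.
have wv : v != w by apply: contraNneq uv => ->.
(* The coefficients 1, -2, 1 sum to zero, so the total mass is unchanged; the condition on t^2
   covers both signs of the step. *)
have le1 t : t ^+ 2 = s ^+ 2 ->
    qform W (fun i => y i + t * d i) <= (\sum_u y u) ^+ 2.
  move=> t2.
  have -> : \sum_u y u = \sum_i (y i + t * d i).
    rewrite big_split /= -mulr_sumr; under [X in _ * X]eq_bigr do rewrite -[d _]mulr1.
    by rewrite sum_bump3; ring.
  apply: qform_le => i; have := y0 i.
  have /orP[/eqP->|/eqP->] : (t == s) || (t == - s) by rewrite -eqf_sqr t2.
    rewrite /d /bump3; have [->|_] := eqVneq i u.
      by rewrite (negPf wu) (negPf vu) /=; lra.
    have [->|_] := eqVneq i v; first by rewrite (negPf wv) /=; lra.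
    by have [->|_] := eqVneq i w => /=; lra.
  rewrite /d /bump3; have [->|_] := eqVneq i u.
    by rewrite (negPf wu) (negPf vu) /=; lra.
  have [->|_] := eqVneq i v; first by rewrite (negPf wv) /=; lra.
  by have [->|_] := eqVneq i w => /=; lra.
(* Adding the two inequalities cancels the linear term and leaves 2 s^2 W(u,w) <= 0, a
   contradiction. *)
have := le1 s erefl; have := le1 (- s) (sqrrN s).
rewrite !qformD // qform_bump3 // !diag (W_nonadj uv) (W_nonadj vw) -yQ sqrrN.
have := mulr_gt0 (exprn_gt0 2 s0) (W_gt0 _ _ uw); lra.
Qed.

End LocalMotzkinStraus.

(** * Cliques, sums over edges, and eigenvectors as functions on vertices *)

Section Cliques.

Context (T : finType) (e : rel T).
Hypothesis e_sym : symmetric e.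
Hypothesis e_irr : irreflexive e.

Lemma cliqueP (K : {set T}) :
  reflect {in K &, forall x y, x != y -> e x y} (clique e K).
Proof.
apply: (iffP forall_inP) => [H x y xK yK xy | H x xK].
  by have /forall_inP/(_ y yK)/implyP/(_ xy) := H x xK.
by apply/forall_inP => y yK; apply/implyP => xy; apply: H.
Qed.

Lemma clique_number_max (K : {set T}) : clique e K -> (#|K| <= clique_number e)%N.
Proof. by move=> clK; rewrite /clique_number (bigop.bigmax_sup K). Qed.

Lemma edge_clique_order_max (K E : {set T}) :
  clique e K -> E \subset K -> (#|K| <= edge_clique_order e E)%N.
Proof. by move=> clK EK; rewrite /edge_clique_order (bigop.bigmax_sup K) ?clK. Qed.

Lemma edge_clique_order_le (E : {set T}) :
  (edge_clique_order e E <= clique_number e)%N.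
Proof. by apply/bigop.bigmax_leqP => K /andP[clK _]; apply: clique_number_max. Qed.

Lemma adj_neq (x y : T) : e x y -> x != y.
Proof. by apply: contraTneq => ->; rewrite e_irr. Qed.

Lemma edge_clique_order_ge2 (x y : T) : e x y ->
  (2 <= edge_clique_order e [set x; y])%N.
Proof.
move=> exy; have <- : #|[set x; y]| = 2%N by rewrite cards2 adj_neq.
apply: edge_clique_order_max => //; apply/cliqueP => u v.
by rewrite !inE => /orP[]/eqP-> /orP[]/eqP->; rewrite ?eqxx // e_sym.
Qed.

Lemma clique_number_ge2_edge : (2 <= clique_number e)%N -> exists x y, e x y.
Proof.
move=> ge2; have [/existsP[x /existsP[y exy]]|] := boolP [exists x, exists y, e x y].
  by exists x, y.
rewrite negb_exists => /forallP noe; suff : (clique_number e <= 1)%N.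
  by rewrite leqNgt ge2.
apply/bigop.bigmax_leqP => K /cliqueP clK; apply/card_le1_eqP => x y xK yK.
apply/eqP; apply: contraT => xy.
by have := noe x; rewrite negb_exists => /forallP/(_ y); rewrite (clK x y) // eq_sym.
Qed.

(** Each edge comes from exactly two ordered pairs, which are distinct since there are no loops. *)
Lemma sum_edges (R : realFieldType) (g : {set T} -> R) :
  2 * \sum_(E in edges e) g E = \sum_(p | e p.1 p.2) g [set p.1; p.2].
Proof.
rewrite (partition_big (fun p : T * T => [set p.1; p.2]) (mem (edges e))) /=; last first.
  move=> [x y] /= exy; rewrite inE.
  by apply/existsP; exists x; apply/existsP; exists y; rewrite exy eqxx.
rewrite mulr_sumr; apply: eq_bigr => E.
rewrite inE => /existsP[x /existsP[y /andP[exy /eqP->]]].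
have xy := adj_neq exy.
rewrite (bigD1 (x, y)) /= ?exy ?eqxx // (bigD1 (y, x)) /=; last first.
  by rewrite e_sym exy setUC eqxx /= xpair_eqE negb_and eq_sym xy.
rewrite big1 => [|[u v] /= /andP[/andP[/andP[euv /eqP uvE]]]].
  by rewrite addr0 [X in _ + g X]setUC; ring.
have : u \in [set x; y] by rewrite -uvE set21.
have : v \in [set x; y] by rewrite -uvE set22.
by rewrite !inE => /orP[]/eqP vE /orP[]/eqP uE; move: euv; rewrite vE uE ?e_irr ?eqxx.
Qed.

Lemma eigenvalue_adjacencyP (R : realFieldType) (mu : R) :
  eigenvalue (adjacency_mx R e) mu <->
  exists2 x : T -> R, (forall v, \sum_(u | e u v) x u = mu * x v) & exists u, x u != 0.
Proof.
have sumE (x : T -> R) v : \sum_(u | e u v) x u =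
    \sum_(i < #|T|) x (enum_val i) * (e (enum_val i) v)%:R.
  rewrite (reindex (@enum_val _ (mem T))) /=; last exact/onW_bij/enum_val_bij.
  by rewrite big_mkcond; apply: eq_bigr => i _; case: (e _ _); rewrite ?mulr1 ?mulr0.
split=> [/eigenvalueP[v vA v0]|[x xE [u xu]]].
  exists (fun u => v 0 (enum_rank u)) => [u|].
    rewrite sumE; have := congr1 (fun M : 'rV_#|T| => M 0 (enum_rank u)) vA.
    rewrite !mxE => <-; apply: eq_bigr => i _.
    by rewrite !mxE enum_rankK enum_valK.
  apply/existsP; apply: contraNT v0; rewrite negb_exists => /forallP v0.
  apply/eqP/rowP => i; rewrite mxE.
  by have := v0 (enum_val i); rewrite negbK enum_valK => /eqP.
apply/eigenvalueP; exists (\row_i x (enum_val i)).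
  apply/rowP => j; rewrite !mxE -xE sumE.
  by apply: eq_bigr => i _; rewrite !mxE.
apply: contraNneq xu => /rowP/(_ (enum_rank u)).
by rewrite !mxE enum_rankK => ->.
Qed.

End Cliques.

(** * Cliques and degrees in complete multipartite graphs *)

Section Multipartite.

Context (T : finType) (e : rel T) (k : nat) (P : {set {set T}}).
Hypothesis eP : complete_multipartite_classes e k P.

Let trivP : trivIset P. Proof. by case: eP. Qed.
Let adjE x y : e x y = [&& x \in cover P, y \in cover P & pblock P x != pblock P y].
Proof. by case: eP. Qed.

(** Representatives of different classes are adjacent, hence also distinct. *)
Lemma multipartite_section_clique (f : {set T} -> T) :
  {in P, forall B, f B \in B} -> clique e (f @: P) /\ #|f @: P| = k.
Proof.
move=> fP; have pf B : B \in P -> pblock P (f B) = B.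
  by move=> BP; apply: def_pblock (fP B BP).
have cf B : B \in P -> f B \in cover P.
  by move=> BP; apply/bigcupP; exists B => //; apply: fP.
split.
  apply/cliqueP => _ _ /imsetP[A AP ->] /imsetP[B BP ->] AB.
  by rewrite adjE !cf // !pf //=; apply: contraNneq AB => ->.
rewrite card_in_imset; first by case: eP.
by move=> A B AP BP AB; rewrite -(pf A AP) AB pf.
Qed.

Lemma multipartite_clique_number : (0 < k)%N -> clique_number e = k.
Proof.
move=> k0; apply/eqP; rewrite eqn_leq; apply/andP; split.
  apply/bigop.bigmax_leqP => K /cliqueP clK.
  (* A one-vertex clique may be an isolated vertex outside [cover P]. In a larger clique every
     vertex has a neighbour, so it lies in a class, and no two share one. *)
  have [/leq_trans->//|K2] := leqP #|K| 1.
  have adjK x : x \in K -> exists2 y, y \in K & e x y.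
    move=> xK; have /card_gt0P[y] : (0 < #|K :\ x|)%N.
      by move: K2; rewrite (cardsD1 x K) xK.
    by rewrite !inE eq_sym => /andP[xy yK]; exists y => //; apply: clK.
  have <- : #|pblock P @: K| = #|K|.
    apply: card_in_imset => x y xK yK xy; apply/eqP; apply: contraT => /clK.
    by rewrite adjE xy eqxx !andbF; apply.
  case: eP => _ _ <- _; apply/subset_leq_card/subsetP => _ /imsetP[x xK ->].
  by have [y _] := adjK x xK; rewrite adjE => /and3P[xP _ _]; apply: pblock_mem.
(* [t0] is only a default for [odflt]: the classes are nonempty, so it is never returned. *)
have [t0 _] : exists t0 : T, t0 \in cover P.
  case: eP => _ P0 Pk _; have /card_gt0P[B BP] : (0 < #|P|)%N by rewrite Pk.
  have /set0Pn[t tB] : B != set0 by apply: contraNneq P0 => <-.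
  by exists t; apply/bigcupP; exists B.
have [|clK <-] := @multipartite_section_clique (fun B => odflt t0 [pick t in B]).
  move=> B BP /=; case: pickP => //= B0; case: eP => _ /negP[].
  by rewrite (_ : set0 = B) //; apply/setP => t; rewrite B0 inE.
exact: clique_number_max.
Qed.

(** A system of representatives chosen to contain [u] and [v] is a clique of order k through the
    edge, and k is the clique number. *)
Lemma multipartite_edge_order (u v : T) :
  e u v -> edge_clique_order e [set u; v] = k.
Proof.
move=> euv; have := euv; rewrite adjE => /and3P[uP vP uv].
have k0 : (0 < k)%N.
  by case: eP => _ _ <- _; apply/card_gt0P; exists (pblock P u); apply: pblock_mem.
apply/eqP; rewrite eqn_leq -{1}(multipartite_clique_number k0) edge_clique_order_le.
pose f B := if B == pblock P u then u else if B == pblock P v then v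
  else odflt u [pick t in B].
have [|clK <-] := @multipartite_section_clique f.
  move=> B BP; rewrite /f; have [->|_] := eqVneq B; first by rewrite mem_pblock.
  have [->|_] := eqVneq B; first by rewrite mem_pblock.
  case: pickP => //= B0; case: eP => _ /negP[].
  by rewrite (_ : set0 = B) //; apply/setP => t; rewrite B0 inE.
apply: edge_clique_order_max => //; rewrite subUset !sub1set; apply/andP; split.
  by apply/imsetP; exists (pblock P u); rewrite ?pblock_mem // /f eqxx.
by apply/imsetP; exists (pblock P v); rewrite ?pblock_mem // /f eq_sym (negPf uv) eqxx.
Qed.

Lemma multipartite_degree (u : T) : u \in cover P ->
  (#|[set v | e u v]| + #|pblock P u|)%N = #|cover P|.
Proof.
move=> uP; have sub : pblock P u \subset cover P.
  by apply/subsetP => v vu; apply/bigcupP; exists (pblock P u); rewrite ?pblock_mem.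
have -> : [set v | e u v] = cover P :\: pblock P u.
  by apply/setP => v; rewrite !inE adjE uP /= eq_pblock // andbC.
by rewrite cardsD (setIidPr sub) subnK // subset_leq_card.
Qed.

End Multipartite.

(** Nonadjacency is an equivalence relation on the non-isolated vertices, and its classes are the
    parts. Isolated vertices are left out because they are nonadjacent to everything. *)
Lemma multipartite_of_nonadj_trans (T : finType) (e : rel T) :
  symmetric e -> irreflexive e ->
  (forall u v w, [exists t, e u t] -> [exists t, e v t] -> [exists t, e w t] ->
     ~~ e u v -> ~~ e v w -> ~~ e u w) ->
  exists2 P : {set {set T}}, complete_multipartite_classes e #|P| P &
    forall u, (u \in cover P) = [exists t, e u t].
Proof.
move=> e_sym e_irr tr; set D := [set u | [exists t, e u t]].
pose r u v := ~~ e u v.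
have eqr : {in D & &, equivalence_rel r}.
  move=> u v w; rewrite !inE => uD vD wD; rewrite /r e_irr; split=> // uv.
  apply/idP/idP => [uw|vw]; last exact: tr uv vw.
  by apply: tr uw => //; rewrite e_sym.
have /and3P[/eqP covP trivP P0] := equivalence_partitionP eqr.
exists (equivalence_partition r D); last by move=> u; rewrite covP inE.
split=> // x y; rewrite covP; have [xD|] := boolP (x \in D); last first.
  by apply: contraNF => exy; rewrite inE; apply/existsP; exists y.
have [yD|] := boolP (y \in D); last first.
  by apply: contraNF => exy; rewrite inE; apply/existsP; exists x; rewrite e_sym.
by rewrite /= eq_pblock ?covP // pblock_equivalence_partition // negbK.
Qed.

(** * The bound for an eigenvalue and the structure of extremal graphs *)

Section LocalTuran.

Context (R : realFieldType) (T : finType) (e : rel T).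
Hypothesis e_sym : symmetric e.
Hypothesis e_irr : irreflexive e.

(** The value 0 off the edges makes this an instance of the matrix [W] of the local Motzkin-Straus
    inequality. *)
Definition edge_weight (u v : T) : R :=
  if e u v then (edge_clique_order e [set u; v])%:R /
                ((edge_clique_order e [set u; v])%:R - 1) else 0.

(** The radicand of the bound; summing over ordered pairs absorbs the factor 2. *)
Definition turan_sum : R := \sum_(p | e p.1 p.2) (edge_weight p.1 p.2)^-1.

Lemma turan_sumE :
  turan_sum = 2 * \sum_(E in edges e)
    ((edge_clique_order e E)%:R - 1) / (edge_clique_order e E)%:R.
Proof.
rewrite sum_edges //; apply: eq_bigr => p ep.
by rewrite /edge_weight ep invf_div.
Qed.

Lemma edge_weight_sym u v : edge_weight u v = edge_weight v u.
Proof. by rewrite /edge_weight e_sym setUC. Qed.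

Lemma edge_weight_gt0 u v : e u v -> 0 < edge_weight u v.
Proof.
move=> euv; rewrite /edge_weight euv.
have c2 := edge_clique_order_ge2 e_sym e_irr euv.
by rewrite divr_gt0 ?subr_gt0 ?ltr1n ?ltr0n // ltnW.
Qed.

Lemma edge_weight_nonadj u v : ~~ e u v -> edge_weight u v = 0.
Proof. by rewrite /edge_weight => /negPf->. Qed.

(** The function t / (t - 1) decreases for t > 1, and the largest clique through the edge has at
    least |K| vertices. *)
Lemma edge_weight_clique (K : {set T}) u v : clique e K ->
  u \in K -> v \in K -> u != v -> edge_weight u v * (#|K|%:R - 1) <= #|K|%:R.
Proof.
move=> clK uK vK uv; have euv : e u v by move/cliqueP: clK; apply.
rewrite /edge_weight euv; set c := edge_clique_order _ _.
have c1 : 0 < c%:R - 1 :> R.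
  by rewrite subr_gt0 ltr1n; apply: edge_clique_order_ge2.
have Kc : #|K|%:R <= c%:R :> R.
  by rewrite ler_nat edge_clique_order_max // subUset !sub1set uK.
rewrite mulrAC ler_pdivrMr //; lra.
Qed.

Lemma turan_sum_gt0 u v : e u v -> 0 < turan_sum.
Proof.
move=> euv; rewrite /turan_sum (bigD1 (u, v)) //=.
rewrite ltr_pwDl ?invr_gt0 ?edge_weight_gt0 //.
by apply: sumr_ge0 => p /andP[ep _]; rewrite invr_ge0 ltW // edge_weight_gt0.
Qed.

Context (mu : R) (x : T -> R).
Hypothesis x_eigen : forall v, \sum_(u | e u v) x u = mu * x v.

Let sq u := x u ^+ 2.

Lemma eigen_quadratic :
  mu * (\sum_u sq u) = \sum_(p | e p.1 p.2) x p.1 * x p.2.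
Proof.
rewrite mulr_sumr -(pair_big_dep xpredT e (fun u v => x u * x v)) /=.
apply: eq_bigr => u _; rewrite /sq expr2 mulrA -x_eigen mulr_suml.
by apply: eq_big => [v|v _]; [rewrite e_sym | rewrite mulrC].
Qed.

Lemma qform_sqE :
  qform edge_weight sq =
  \sum_(p | e p.1 p.2) edge_weight p.1 p.2 * (x p.1 * x p.2) ^+ 2.
Proof.
rewrite -(pair_big_dep xpredT e (fun u v => edge_weight u v * (x u * x v) ^+ 2)) /=.
apply: eq_bigr => u _; rewrite [RHS]big_mkcond mulr_sumr; apply: eq_bigr => v _.
by case: ifP => euv; [rewrite /sq; ring | rewrite edge_weight_nonadj ?euv //; ring].
Qed.

Lemma eigen_cauchy : (mu * \sum_u sq u) ^+ 2 <= turan_sum * qform edge_weight sq.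
Proof.
rewrite eigen_quadratic qform_sqE /turan_sum.
by apply: weighted_cauchy => p; apply: edge_weight_gt0.
Qed.

Lemma eigen_qform_le : qform edge_weight sq <= (\sum_u sq u) ^+ 2.
Proof.
apply: (qform_le e_sym e_irr edge_weight_sym edge_weight_nonadj edge_weight_clique).
by move=> u; apply: sqr_ge0.
Qed.

Hypothesis x_neq0 : exists u, x u != 0.

Let norm_gt0 : 0 < \sum_u sq u.
Proof.
have [u xu] := x_neq0; rewrite (bigD1 u) //= ltr_pwDl ?exprn_even_gt0 //.
by apply: sumr_ge0 => v _; apply: sqr_ge0.
Qed.

Lemma turan_sum_ge0 : 0 <= turan_sum.
Proof.
by apply: sumr_ge0 => p ep; rewrite invr_ge0 ltW // edge_weight_gt0.
Qed.

Lemma eigen_sq_le : mu ^+ 2 <= turan_sum.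
Proof.
(* The eigenvector is not normalised; instead both sides are multiplied by (sum x^2)^2. *)
rewrite -(ler_pM2r (exprn_gt0 2 norm_gt0)) -exprMn.
by apply: le_trans eigen_cauchy _; rewrite ler_wpM2l ?turan_sum_ge0 ?eigen_qform_le.
Qed.

Hypothesis mu_sq : mu ^+ 2 = turan_sum.
Hypothesis has_edge : exists u v, e u v.

Let sum_gt0 : 0 < turan_sum.
Proof. by have [u [v]] := has_edge; apply: turan_sum_gt0. Qed.

(** With N = sum x^2, S = [turan_sum] and Q the form at x^2, the chain mu^2 N^2 <= S Q <= S N^2 has
    equal ends, and S > 0 can be cancelled. *)
Lemma extremal_qform : qform edge_weight sq = (\sum_u sq u) ^+ 2.
Proof.
apply/le_anti; rewrite eigen_qform_le /= -(ler_pM2l sum_gt0) -{1}mu_sq -exprMn.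
exact: eigen_cauchy.
Qed.

Lemma extremal_products p q : e p.1 p.2 -> e q.1 q.2 ->
  edge_weight p.1 p.2 * (x p.1 * x p.2) = edge_weight q.1 q.2 * (x q.1 * x q.2).
Proof.
apply: (@weighted_cauchy_eq R _ (fun p => e p.1 p.2)
  (fun p => edge_weight p.1 p.2) (fun p => x p.1 * x p.2)) => [r|].
  exact: edge_weight_gt0.
by rewrite -eigen_quadratic -qform_sqE extremal_qform exprMn mu_sq.
Qed.

(** A zero at an endpoint of one edge makes the common value of w(uv) x_u x_v zero on all edges, so
    mu = 0, against mu^2 = [turan_sum] > 0. *)
Lemma extremal_neq0 u v : e u v -> x u != 0.
Proof.
move=> euv; apply/eqP => xu0.
have : (mu * \sum_u sq u) ^+ 2 = 0.
  rewrite eigen_quadratic big1 ?expr0n // => p ep.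
  have := extremal_products (p := p) (q := (u, v)) ep euv.
  rewrite /= xu0 mul0r mulr0 => /eqP.
  by rewrite mulf_eq0 (gt_eqF (edge_weight_gt0 ep)) => /eqP.
by apply/eqP; rewrite exprMn mu_sq gt_eqF // mulr_gt0 // exprn_gt0.
Qed.

Lemma extremal_multipartite :
  exists2 P : {set {set T}}, complete_multipartite_classes e #|P| P &
    forall u, (u \in cover P) = [exists t, e u t].
Proof.
apply: multipartite_of_nonadj_trans => // u v w.
move=> /existsP[u' uu'] /existsP[v' vv'] /existsP[w' ww'].
have pos a b : e a b -> 0 < sq a.
  by move=> eab; rewrite exprn_even_gt0 //= (extremal_neq0 eab).
apply: (qform_eq_nonadj_trans e_sym e_irr edge_weight_sym edge_weight_nonadj
  edge_weight_clique _ edge_weight_gt0 extremal_qform (pos _ _ uu') (pos _ _ vv')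
  (pos _ _ ww')).
by move=> a; apply: sqr_ge0.
Qed.

(** All edges have c = k and hence equal weights, so x_u x_v is constant on edges. Common neighbours
    then make [x] constant on [cover P], and degrees equal [mu]. *)
Lemma extremal_regular (P : {set {set T}}) k :
  complete_multipartite_classes e k P -> (3 <= k)%N ->
  (forall u, (u \in cover P) = [exists t, e u t]) ->
  {in P &, forall A B : {set T}, #|A| = #|B|}.
Proof.
move=> eP k3 covP; have [trivP P0 Pk adjE] := eP.
have x_prod u v u' v' : e u v -> e u' v' -> x u * x v = x u' * x v'.
  move=> uv uv'; have := extremal_products (p := (u, v)) (q := (u', v')) uv uv' => /=.
  have -> : edge_weight u' v' = edge_weight u v.
    by rewrite /edge_weight uv uv' !(multipartite_edge_order eP).
  by apply: mulfI; rewrite gt_eqF // edge_weight_gt0.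
have x_const u v : u \in cover P -> v \in cover P -> x u = x v.
  move=> uP vP.
  (* As k >= 3, some class contains neither [u] nor [v]; its vertices are common neighbours of
     both. *)
  have /set0Pn[B] : P :\: [set pblock P u; pblock P v] != set0.
    rewrite -card_gt0 -(ltn_add2r #|P :&: [set pblock P u; pblock P v]|) add0n.
    rewrite addnC cardsID Pk; apply: leq_ltn_trans k3.
    by rewrite (leq_trans (subset_leq_card (subsetIr _ _))) // cards2; case: eqP.
  rewrite !inE negb_or => /andP[/andP[Bu Bv] BP].
  have /set0Pn[w wB] : B != set0 by apply: contraNneq P0 => <-.
  have wP : w \in cover P by apply/bigcupP; exists B.
  have euw : e u w by rewrite adjE uP wP (def_pblock trivP BP wB) eq_sym.
  have evw : e v w by rewrite adjE vP wP (def_pblock trivP BP wB) eq_sym.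
  have xw : x w != 0 by apply: (@extremal_neq0 w u); rewrite e_sym.
  by apply: (mulIf xw); apply: x_prod.
(* The eigenvalue equation at [u], divided by the constant nonzero value of [x], counts the
   neighbours of [u]. *)
have deg u : u \in cover P -> mu = #|[set v | e u v]|%:R.
  move=> uP; have xu : x u != 0.
    by move: (uP); rewrite covP => /existsP[v]; apply: extremal_neq0.
  apply: (mulIf xu); rewrite -x_eigen mulr_natl -sumr_const.
  apply: eq_big => [v|v evu]; first by rewrite inE e_sym.
  by apply: x_const => //; rewrite covP; apply/existsP; exists u.
move=> A B AP BP.
have pick C : C \in P -> exists2 u, u \in cover P & pblock P u = C.
  move=> CP; have /set0Pn[u uC] : C != set0 by apply: contraNneq P0 => <-.
  by exists u; [apply/bigcupP; exists C | apply: def_pblock].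
have [u uP <-] := pick A AP; have [v vP <-] := pick B BP.
have : #|[set t | e u t]|%:R = #|[set t | e v t]|%:R :> R by rewrite -!deg.
move/eqP; rewrite eqr_nat => /eqP degE.
apply/eqP; rewrite -(eqn_add2l #|[set t | e u t]|) (multipartite_degree eP uP) degE.
by rewrite (multipartite_degree eP vP).
Qed.

End LocalTuran.

(** * Eigenvectors showing that the extremal graphs attain the bound *)

Section Converse.

Context (R : rcfType) (T : finType) (e : rel T) (k : nat) (P : {set {set T}}).
Hypothesis e_sym : symmetric e.
Hypothesis eP : complete_multipartite_classes e k P.

Lemma multipartite_turan_sum :
  turan_sum R e = (k%:R - 1) / k%:R * \sum_(u in cover P) #|[set v | e u v]|%:R.
Proof.
have [_ _ _ adjE] := eP.
rewrite /turan_sum -(pair_big_dep xpredT e (fun u v => (edge_weight R e u v)^-1)) /=.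
rewrite mulr_sumr [RHS]big_mkcond; apply: eq_bigr => u _; case: ifPn => uP.
  rewrite mulr_natr -sumr_const; apply: eq_big => v; first by rewrite inE.
  by move=> euv; rewrite /edge_weight euv (multipartite_edge_order eP euv) invf_div.
by rewrite big1 // => v; rewrite adjE (negPf uP).
Qed.

Lemma bipartite_eigenvalue : k = 2%N ->
  eigenvalue (adjacency_mx R e) (Num.sqrt (turan_sum R e)).
Proof.
have [trivP P0 Pk adjE] := eP => k2.
have /cards2P[A [B [AB PAB]]] : #|P| == 2%N by rewrite Pk k2.
have covP : cover P = A :|: B by rewrite PAB /cover big_setU1 ?big_set1 // inE.
have AP : A \in P by rewrite PAB set21.
have BP : B \in P by rewrite PAB set22.
have pA u : u \in A -> pblock P u = A by apply: def_pblock.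
have pB u : u \in B -> pblock P u = B by apply: def_pblock.
have NB u : u \in A -> (u \in B) = false.
  by move=> uA; apply: contraNF AB => uB; rewrite -(pA u uA) pB.
have adjA u v : u \in A -> e v u = (v \in B).
  move=> uA; rewrite e_sym adjE covP !inE uA (pA u uA) /=.
  have [vA|_] := boolP (v \in A); first by rewrite pA // eqxx NB.
  by have [/pB->|] := boolP (v \in B).
have adjB u v : u \in B -> e v u = (v \in A).
  move=> uB; rewrite e_sym adjE covP !inE uB orbT (pB u uB) /=.
  have [vA|_] := boolP (v \in A); first by rewrite pA // eq_sym.
  by have [/pB->|] := boolP (v \in B); rewrite ?eqxx.
set a : R := #|A|%:R; set b : R := #|B|%:R.
have a0 : 0 <= a := ler0n _ _; have b0 : 0 <= b := ler0n _ _.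
(* Vertices of [A] have degree b and those of [B] degree a, so the degree sum is 2 a b, and the
   factor (k - 1) / k is 1/2. *)
have -> : turan_sum R e = a * b.
  rewrite multipartite_turan_sum covP (eq_bigl _ _ (fun u => in_setU u A B)) bigU /=; last first.
    by rewrite disjoint_subset; apply/subsetP => u uA; rewrite !inE NB.
  rewrite (eq_bigr (fun=> b)) => [|u uA]; last first.
    by congr (_%:R); apply: eq_card => v; rewrite inE e_sym adjA.
  rewrite [X in _ * (_ + X)](eq_bigr (fun=> a)) => [|u uB]; last first.
    by congr (_%:R); apply: eq_card => v; rewrite inE e_sym adjB.
  by rewrite !sumr_const k2 -[b *+ _]mulr_natr -[a *+ _]mulr_natr; field.
rewrite sqrtrM //; apply/(eigenvalue_adjacencyP e).
have [sa sb] := (sqr_sqrtr a0, sqr_sqrtr b0).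
(* These values balance the two sides: at a vertex of [A], b sqrt(a) = sqrt(a b) sqrt(b), and
   symmetrically on [B]. *)
exists (fun u => if u \in A then Num.sqrt b else
                 if u \in B then Num.sqrt a else 0) => [v|].
  have [vA|vA] := boolP (v \in A).
    rewrite (eq_bigl (mem B)) => [|u]; last by rewrite adjA.
    rewrite (eq_bigr (fun=> Num.sqrt a)) => [|u /= uB]; last first.
      by rewrite uB; case: ifP => // /NB; rewrite uB.
    by rewrite sumr_const -mulr_natr -/b -{1}sb; ring.
  have [vB|vB] := boolP (v \in B).
    rewrite (eq_bigl (mem A)) => [|u]; last by rewrite adjB.
    rewrite (eq_bigr (fun=> Num.sqrt b)) => [|u /= ->] //.
    by rewrite sumr_const -mulr_natr -/a -{1}sa; ring.
  rewrite mulr0 big1 // => u; rewrite e_sym adjE covP !inE (negPf vA) (negPf vB).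
  by [].
have /set0Pn[u uA] : A != set0 by apply: contraNneq P0 => <-.
have Bn0 : B != set0 by apply: contraNneq P0 => <-.
by exists u; rewrite uA sqrtr_eq0 -ltNge ltr0n card_gt0.
Qed.

(** With classes of size b, the k b vertices of [cover P] have degree (k - 1) b, so [turan_sum] is
    the square of this degree. The indicator of [cover P] is an eigenvector for it. *)
Lemma regular_multipartite_eigenvalue : (0 < k)%N ->
  {in P &, forall A B : {set T}, #|A| = #|B|} ->
  eigenvalue (adjacency_mx R e) (Num.sqrt (turan_sum R e)).
Proof.
have [trivP P0 Pk adjE] := eP => k0 eqP.
have [B BP] : exists B, B \in P by apply/card_gt0P; rewrite Pk.
have /set0Pn[t tB] : B != set0 by apply: contraNneq P0 => <-.
have covk : #|cover P| = (k * #|B|)%N.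
  rewrite -Pk; apply: card_uniform_partition; first by move=> A AP; apply: eqP.
  by rewrite /partition eqxx trivP.
have deg u : u \in cover P -> #|[set v | e u v]|%:R = (k%:R - 1) * #|B|%:R :> R.
  move=> uP; have := multipartite_degree eP uP.
  rewrite covk (eqP _ B (pblock_mem uP) BP) => /(congr1 (fun n => n%:R : R)).
  rewrite natrD natrM; lra.
have k1 : 0 <= k%:R - 1 :> R by rewrite subr_ge0 ler1n.
have -> : turan_sum R e = ((k%:R - 1) * #|B|%:R) ^+ 2.
  rewrite multipartite_turan_sum (eq_bigr _ deg) sumr_const -[X in _ * X]mulr_natr covk.
  rewrite natrM; field.
  by rewrite pnatr_eq0 -lt0n.
rewrite sqrtr_sqr ger0_norm ?mulr_ge0 //.
apply/(eigenvalue_adjacencyP e).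
exists (fun u => (u \in cover P)%:R) => [v|]; last first.
  by exists t; rewrite (_ : t \in cover P) ?oner_eq0 //; apply/bigcupP; exists B.
have [vP|vP] := boolP (v \in cover P); last first.
  by rewrite mulr0 big1 // => u; rewrite adjE (negPf vP) andbF.
rewrite mulr1 -(deg v vP) -sumr_const; apply: eq_big => [u|u].
  by rewrite inE e_sym.
by rewrite adjE => /andP[->].
Qed.

End Converse.

(** * The spectral bound and the characterisation of equality *)

Theorem theorem3p1 (R : realType) (T : finType) (e : rel T)
    (e_sym : symmetric e) (e_irr : irreflexive e)
    (omega_ge2 : (2 <= clique_number e)%N) :
  let omega := clique_number e in
  let bound : R :=
    Num.sqrt (2 * \sum_(E in edges e)
      ((edge_clique_order e E)%:R - 1) / (edge_clique_order e E)%:R) in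
  spectral_radius R e <= bound /\
  (spectral_radius R e = bound <->
     (omega = 2%N /\ complete_bipartite_upto_isolated e) \/
     ((3 <= omega)%N /\ complete_regular_multipartite_upto_isolated e omega)).
Proof.
move=> omega bound; rewrite /bound -turan_sumE // {bound}.
have edge := clique_number_ge2_edge omega_ge2.
have T0 : (0 < #|T|)%N by have [u _] := edge; apply/card_gt0P; exists u.
have [eig_rho rho_max] := spectral_radius_largest R e_sym T0.
have /eigenvalue_adjacencyP[x x_eigen x_neq0] := eig_rho.
have rho_le : spectral_radius R e <= Num.sqrt (turan_sum R e).
  (* The bound on the square controls |rho| = sqrt(rho^2), which dominates rho. *)
  apply: le_trans (ler_norm _) _.
  by rewrite -sqrtr_sqr ler_sqrt ?turan_sum_ge0 // (eigen_sq_le e_sym e_irr x_eigen).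
split=> //; split=> [rhoE|].
  have rho_sq : spectral_radius R e ^+ 2 = turan_sum R e.
    by rewrite rhoE sqr_sqrtr // turan_sum_ge0.
  have [P eP covP] := extremal_multipartite e_sym e_irr x_eigen x_neq0 rho_sq edge.
  have omegaE : omega = #|P|.
    apply: (multipartite_clique_number eP); apply/card_gt0P.
    have [u [v euv]] := edge; exists (pblock P u); apply: pblock_mem.
    by rewrite covP; apply/existsP; exists v.
  rewrite -omegaE in eP.
  have [omega3|omega2] := leqP 3 omega; [right | left].
    split=> //; exists P; split=> //.
    exact: (extremal_regular e_sym e_irr x_eigen x_neq0 rho_sq edge eP).
  have <- : omega = 2%N by apply/eqP; rewrite eqn_leq -ltnS omega2.
  by split=> //; exists P; have -> : 2%N = omega by apply/eqP; rewrite eqn_leq omega_ge2 -ltnS.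
(* Since the spectral radius is the largest eigenvalue, it is enough that the bound itself is an
   eigenvalue. *)
move=> H; apply/le_anti; rewrite rho_le; apply: rho_max.
case: H => [[_ [P eP]] | [omega3 [P [eP eqP]]]].
  exact: (bipartite_eigenvalue R e_sym eP).
by apply: (regular_multipartite_eigenvalue R e_sym eP) => //; apply: ltnW.
Qed.
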